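(* Let $\mathbf{C}$ be the $p$th-degree NURBS curve on $[u_i,u_{i+1}]$ with control points $\mathbf{p}_{i-p},\dots,\mathbf{p}_i$ and weights $\omega_{i-p},\dots,\omega_i$. Let $J\subseteq\{i-p,\dots,i\}$ have cardinality $|J|$ with $1<|J|\le p+1$, and regard the weights $(\omega_j)_{j\in J}$ as independent variables, the remaining weights being fixed. Then the multivariable limit of the NURBS curve $\mathbf{C}$ on $[u_i,u_{i+1}]$, as all the weights $\omega_j$, $j\in J$, approach $+\infty$ independently, does not exist.
   Context: Let $\mathbf{U}=\{u_0,\dots,u_m\}$ be a non-decreasing sequence of real numbers (the knot vector), $p\ge 1$ the degree, and $p\le i\le m-p-1$ with $u_i<u_{i+1}$. The B-spline basis functions are defined by $N_{j,0}(u)=1$ if $u_j\le u<u_{j+1}$ and $0$ otherwise, and $N_{j,p}(u)=\frac{u-u_j}{u_{j+p}-u_j}N_{j,p-1}(u)+\frac{u_{j+p+1}-u}{u_{j+p+1}-u_{j+1}}N_{j+1,p-1}(u)$ with the convention $0/0=0$. On the closed interval $[u_i,u_{i+1}]$ the value of $N_{j,p}$ at $u_{i+1}$ is taken as the limit from the left. With control points $\mathbf{p}_j\in\mathbb{R}^d$ and weights $\omega_j>0$, the $p$th-degree NURBS curve on $[u_i,u_{i+1}]$ is $$\mathbf{C}(u)=\frac{\sum_{j=i-p}^{i}N_{j,p}(u)\,\omega_j\,\mathbf{p}_j}{\sum_{j=i-p}^{i}N_{j,p}(u)\,\omega_j},\qquad u\in[u_i,u_{i+1}].$$ The multivariable limit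 of the curve exists if there is a function $\mathbf{L}:[u_i,u_{i+1}]\to\mathbb{R}^d$ such that for every $u\in[u_i,u_{i+1}]$ and every $\varepsilon>0$ there is $\Omega>0$ with $\|\mathbf{C}(u)-\mathbf{L}(u)\|<\varepsilon$ whenever $\omega_j>\Omega$ for all $j\in J$.
   Formalization: The control points p_j, j in J, are additionally assumed not to be all equal; if they all coincide (for example, if all control points are one point, so that the curve is constant), the multivariable limit exists and the claim as stated is false. *)

(* Defs.v *)
From mathcomp Require Import all_boot all_order all_algebra.
From mathcomp Require Import finmap.
From mathcomp Require Import all_classical reals topology normedtype.

Set Implicit Arguments.
Unset Strict Implicit.
Unset Printing Implicit Defensive.

Import Order.TTheory GRing.Theory Num.Theory.
Import numFieldNormedType.Exports.

Local Open Scope classical_set_scope.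
Local Open Scope ring_scope.

(* N_{j,p}(x) for the knots U`_0, ..., U`_m.  The convention 0/0 = 0 is the
   library's: z / 0 = 0 for every z.  Knots past the end of U read as 0; they
   are reached only when j + p + 1 >= size U. *)
Fixpoint bspline (R : realType) (U : seq R) (p j : nat) (x : R) : R :=
  match p with
  | 0 => if U`_j <= x < U`_j.+1 then 1 else 0
  | q.+1 =>
      (x - U`_j) / (U`_(j + q.+1) - U`_j) * bspline U q j x +
      (U`_(j + q.+1 + 1) - x) / (U`_(j + q.+1 + 1) - U`_(j + 1))
        * bspline U q (j + 1) x
  end.

(* N_{j,p} on the closed span [u_i, u_{i+1}]: at the right end point the value
   is the limit from the left, since degree-0 functions are right-continuous. *)
Definition bspline_span (R : realType) (U : seq R) (i p j : nat) (x : R) : R :=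
  if x == U`_i.+1 then lim (bspline U p j y @[y --> x^'-])
  else bspline U p j x.

Definition nurbs (R : realType) (d : nat) (U : seq R) (p i : nat)
    (P : nat -> 'rV[R]_d) (w : nat -> R) (x : R) : 'rV[R]_d :=
  (\sum_(i - p <= j < i.+1) bspline_span U i p j x * w j)^-1 *:
  (\sum_(i - p <= j < i.+1) (bspline_span U i p j x * w j) *: P j).

(* The norm that the library puts on 'rV[R]_d is the sup norm. *)
Definition enorm (R : realType) (d : nat) (v : 'rV[R]_d) : R :=
  Num.sqrt (\sum_(k < d) v ord0 k ^+ 2).

(* Only the values of w outside J matter: those are the fixed weights, while
   w' ranges over all weights agreeing with w outside J.  Only the values of L
   on [u_i, u_{i+1}] matter. *)
Definition multivariable_limit_exists (R : realType) (d : nat) (U : seq R)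
    (p i : nat) (P : nat -> 'rV[R]_d) (w : nat -> R) (J : {fset nat}) : Prop :=
  exists L : R -> 'rV[R]_d,
    forall x : R, U`_i <= x <= U`_i.+1 ->
    forall e : R, 0 < e ->
    exists Omega : R, 0 < Omega /\
      forall w' : nat -> R,
        (forall j : nat, j \notin J -> w' j = w j) ->
        (forall j : nat, j \in J -> Omega < w' j) ->
        enorm (nurbs U p i P w' x - L x) < e.

(* Main.v *)
Require Import Defs.
From mathcomp Require Import all_boot all_order all_algebra.
From mathcomp Require Import finmap.
From mathcomp Require Import all_classical reals topology normedtype.
From mathcomp Require Import zify ring lra.

(** At a parameter [x] strictly inside the span every basis function
    [N_{j,p}] with [i - p <= j <= i] is positive ([bspline_gt0]), so [C(x)] is
    a weighted mean of the control points in which the [j]-th one has weight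
    [N_{j,p}(x) w_j].  A weighted mean with one weight much larger than all the
    others is close to the point carrying that weight
    ([weighted_mean_dominated]).  Hence for every [a] in [J] and every bound
    [Omega] there are admissible weights, all above [Omega], that bring [C(x)]
    arbitrarily close to [P a]: keep the other weights of [J] just above
    [Omega] and let [w_a] grow ([nurbs_near_control_point]).  A limit at [x]
    would therefore be equal to [P a] for all [a] in [J] at once, whereas two
    of these points differ.  One interior parameter, the midpoint of the span,
    is enough, and comparing a single coordinate in which the two points differ
    reduces the argument to real numbers. *)

Set Implicit Arguments.
Unset Strict Implicit.
Unset Printing Implicit Defensive.

Import Order.TTheory GRing.Theory Num.Theory.
Import numFieldNormedType.Exports.

Local Open Scope fset_scope.
Local Open Scope ring_scope.

Lemma knot_le (R : realType) (U : seq R) (j k : nat) :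
  sorted <=%R U -> (j <= k)%N -> (k < size U)%N -> U`_j <= U`_k.
Proof.
move=> U_le le_jk lt_k; apply: (sorted_leq_nth le_trans lexx) => //.
by rewrite inE; apply: leq_ltn_trans lt_k.
Qed.

Lemma bspline_eq0 (R : realType) (U : seq R) (i q j : nat) (x : R) :
  sorted <=%R U -> U`_i < x < U`_i.+1 -> (i.+1 < size U)%N ->
  (j + q.+1 < size U)%N -> ~~ (j <= i <= j + q)%N -> bspline U q j x = 0.
Proof.
move=> U_le /andP[ltUx ltxU] ltiU.
elim: q j => [|q IHq] j ltU out_j /=; last first.
  by rewrite !IHq ?mulr0 ?addr0 //; lia.
case: ifP => // /andP[leUx ltxUj].
have [lt_ij | le_ji] := ltnP i j.
  have : U`_i.+1 <= U`_j by apply: knot_le => //; lia.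
  by lra.
have : U`_j.+1 <= U`_i by apply: knot_le => //; lia.
by lra.
Qed.

(** In the recursion, the coefficient of each of the two functions of lower
    degree is positive as soon as that function has the span in its support;
    the functions without the span in their support vanish there by
    [bspline_eq0], and at least one of the two has it. *)
Lemma bspline_gt0 (R : realType) (U : seq R) (i q j : nat) (x : R) :
  sorted <=%R U -> U`_i < x < U`_i.+1 -> (i.+1 < size U)%N ->
  (j + q.+1 < size U)%N -> (j <= i <= j + q)%N -> 0 < bspline U q j x.
Proof.
move=> U_le x_in ltiU; have /andP[ltUx ltxU] := x_in.
elim: q j => [|q IHq] j ltU in_j.
  have -> : j = i by lia.
  by rewrite /= (ltW ltUx) ltxU ltr01.
rewrite [bspline _ _ _ _]/=.
have left_gt0 : (i <= j + q)%N ->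
    0 < (x - U`_j) / (U`_(j + q.+1) - U`_j) * bspline U q j x.
  move=> le_i.
  have leUj : U`_j <= U`_i by apply: knot_le => //; lia.
  have leUi : U`_i.+1 <= U`_(j + q.+1) by apply: knot_le => //; lia.
  by rewrite mulr_gt0 ?divr_gt0 ?IHq //; [lra | lra | lia | lia].
have right_gt0 : (j < i)%N ->
    0 < (U`_(j + q.+1 + 1) - x) / (U`_(j + q.+1 + 1) - U`_(j + 1))
        * bspline U q (j + 1) x.
  move=> lt_j.
  have leUj : U`_(j + 1) <= U`_i by apply: knot_le => //; lia.
  have leUi : U`_i.+1 <= U`_(j + q.+1 + 1) by apply: knot_le => //; lia.
  by rewrite mulr_gt0 ?divr_gt0 ?IHq //; [lra | lra | lia | lia].
have [le_i | lt_i] := leqP i (j + q).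
  have [lt_j | le_j] := ltnP j i; first by rewrite addr_gt0 ?left_gt0 ?right_gt0.
  rewrite [bspline U q (j + 1) x](@bspline_eq0 _ _ i) ?mulr0 ?addr0
    ?left_gt0 //; lia.
rewrite [bspline U q j x](@bspline_eq0 _ _ i) ?mulr0 ?add0r
  ?right_gt0 //; lia.
Qed.

(** With [D] and [S] the sums of the weights and of the weighted values over
    the other indices, the mean minus [f a] is
    [(S - D * f a) / (D + T)], whose numerator does not depend on the
    weight [T] of [a]. *)
Lemma weighted_mean_dominated (R : realFieldType) (I : eqType) (r : seq I)
    (a : I) (c f : I -> R) (e : R) :
  uniq r -> a \in r -> (forall j, j \in r -> j != a -> 0 <= c j) -> 0 < e ->
  exists2 T0 : R, 0 < T0 & forall g : I -> R,
    (forall j, j != a -> g j = c j) -> T0 <= g a ->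
    `|(\sum_(j <- r) g j)^-1 * (\sum_(j <- r) g j * f j) - f a| < e.
Proof.
move=> r_uniq ra c_ge0 e_gt0.
set D := \sum_(j <- r | j != a) c j.
set S := \sum_(j <- r | j != a) c j * f j.
have D_ge0 : 0 <= D.
  by rewrite /D big_seq_cond sumr_ge0 // => j /andP[]; apply: c_ge0.
pose K := `|S - D * f a| / e.
have K_ge0 : 0 <= K by rewrite divr_ge0 // ltW.
exists (K + 1) => [|g g_eq leT]; first by lra.
have -> : \sum_(j <- r) g j = g a + D.
  by rewrite (bigD1_seq a) //=; congr (_ + _); apply: eq_bigr.
have -> : \sum_(j <- r) g j * f j = g a * f a + S.
  rewrite (bigD1_seq a) //=; congr (_ + _).
  by apply: eq_bigr => j ja; rewrite g_eq.
have den_gt0 : 0 < g a + D by lra.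
have -> : (g a + D)^-1 * (g a * f a + S) - f a = (S - D * f a) / (g a + D).
  by field; rewrite gt_eqF.
rewrite normrM normfV (gtr0_norm den_gt0) ltr_pdivrMr //.
by rewrite -ltr_pdivrMl // [e^-1 * _]mulrC -/K; lra.
Qed.

Lemma coord_le_enorm (R : realType) (d : nat) (v : 'rV[R]_d) (k : 'I_d) :
  `|v ord0 k| <= enorm v.
Proof.
rewrite -sqrtr_sqr ler_wsqrtr // (bigD1 k) //= lerDl.
by apply: sumr_ge0 => j _; apply: sqr_ge0.
Qed.

(** The weight of [a] can be sent to infinity before the other weights of [J],
    which is where their independence is used: the threshold for [w_a] depends
    on the others, and these only have to exceed [Omega]. *)
Lemma nurbs_near_control_point (R : realType) (d p i : nat) (U : seq R)
    (P : nat -> 'rV[R]_d) (w : nat -> R) (J : {fset nat}) (a : nat)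
    (k : 'I_d) (x Omega e : R) :
  sorted <=%R U -> (p <= i)%N -> (i + p + 1 < size U)%N ->
  U`_i < x < U`_i.+1 ->
  (forall j : nat, (i - p <= j <= i)%N -> 0 < w j) ->
  a \in J -> (i - p <= a <= i)%N -> 0 < Omega -> 0 < e ->
  exists w' : nat -> R,
    [/\ forall j, j \notin J -> w' j = w j,
        forall j, j \in J -> Omega < w' j &
        `|nurbs U p i P w' x ord0 k - P a ord0 k| < e].
Proof.
move=> U_le le_pi ltU x_in w_gt0 aJ a_in Omega_gt0 e_gt0.
have /andP[_ ltxU] := x_in.
have basis_gt0 j : (i - p <= j <= i)%N -> 0 < bspline_span U i p j x.
  by move=> j_in; rewrite /bspline_span lt_eqF // (bspline_gt0 U_le x_in) //; lia.
pose v j := if j \in J then Omega + 1 else w j.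
pose c j := bspline_span U i p j x * v j.
have mem_range j : (j \in index_iota (i - p) i.+1) = (i - p <= j <= i)%N.
  by rewrite mem_index_iota ltnS.
have [|||//|T0 T0_gt0 near_a] := @weighted_mean_dominated R _
    (index_iota (i - p) i.+1) a c (fun j => P j ord0 k) e.
- exact: iota_uniq.
- by rewrite mem_range.
- move=> j; rewrite mem_range => j_in _.
  rewrite mulr_ge0 ?(ltW (basis_gt0 j j_in)) // /v.
  by case: ifP => _; [lra | rewrite ltW ?w_gt0].
have Ba_gt0 := basis_gt0 a a_in.
(* [T0] is the threshold for the product [N_{a,p}(x) w'_a], hence the division;
   the summand [Omega + 1] keeps the weight of [a] itself above [Omega]. *)
pose w' j := if j == a then Omega + 1 + T0 / bspline_span U i p a x else v j.
exists w'; split.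
- move=> j jJ; rewrite /w' /v (negPf jJ); case: eqP => // ja.
  by rewrite ja aJ in jJ.
- move=> j jJ; rewrite /w' /v jJ; case: eqP => _; last by lra.
  have := divr_gt0 T0_gt0 Ba_gt0; lra.
rewrite /nurbs mxE summxE.
under [X in _ * X]eq_bigr do rewrite mxE.
apply: near_a => [j ja|]; first by rewrite /w' (negPf ja).
rewrite /w' eqxx mulrDr mulrCA divff ?gt_eqF // mulr1 lerDr.
by rewrite mulr_ge0 ?ltW //; lra.
Qed.

Theorem theorem1 (R : realType) (d m p i : nat) (U : (m.+1).-tuple R)
    (P : nat -> 'rV[R]_d) (w : nat -> R) (J : {fset nat})
    (U_nondecreasing : sorted <=%R U)
    (p_ge1 : (1 <= p)%N)
    (i_ge : (p <= i)%N)
    (i_le : (i + p + 1 <= m)%N)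
    (span_nonempty : U`_i < U`_i.+1)
    (w_gt0 : forall j : nat, (i - p <= j <= i)%N -> 0 < w j)
    (J_sub : forall j : nat, j \in J -> (i - p <= j <= i)%N)
    (J_card : (1 < #|` J| <= p.+1)%N)
    (P_nonconst : exists j k : nat, [/\ j \in J, k \in J & P j != P k]) :
  ~ multivariable_limit_exists U p i P w J.

Proof.
have [a [b [aJ bJ Pab]]] := P_nonconst.
case=> L limL.
have /existsP[k Pk] : [exists k, P a ord0 k != P b ord0 k].
  apply: contraR Pab => /existsPn eqP_; apply/eqP/rowP => k.
  by apply/eqP; rewrite -[_ == _]negbK.
pose x := (U`_i + U`_i.+1) / 2.
have x_in : U`_i < x < U`_i.+1 by rewrite /x; apply/andP; split; lra.
(* The triangle inequality through [L x] makes four errors of size [e]. *)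
pose e := `|P a ord0 k - P b ord0 k| / 4.
have e_gt0 : 0 < e by rewrite divr_gt0 // normr_gt0 subr_eq0.
have /limL /(_ e e_gt0) [Omega [Omega_gt0 near_L]] : U`_i <= x <= U`_i.+1.
  by have /andP[/ltW -> /ltW ->] := x_in.
have near_P c : c \in J -> `|P c ord0 k - L x ord0 k| < e + e.
  move=> cJ.
  have [||w' [w'_out w'_in near_c]] := @nurbs_near_control_point R d p i U
    P w J c k x Omega e U_nondecreasing i_ge _ x_in w_gt0 cJ _ Omega_gt0 e_gt0.
  - by rewrite size_tuple; lia.
  - exact: J_sub.
  have := le_lt_trans (coord_le_enorm _ k) (near_L w' w'_out w'_in).
  rewrite mxE [X in _ + X]mxE => near_Lk.
  apply: le_lt_trans (ler_distD (nurbs U p i P w' x ord0 k) _ _) _.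
  by rewrite ltrD // distrC.
have : `|P a ord0 k - P b ord0 k| < (e + e) + (e + e).
  apply: le_lt_trans (ler_distD (L x ord0 k) _ _) _.
  by rewrite ltrD ?near_P // distrC near_P.
have -> : e + e + (e + e) = `|P a ord0 k - P b ord0 k| by rewrite /e; field.
by rewrite ltxx.
Qed.
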